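(* Consider the online configuration selection and admission control problem described in the context, with horizon $T$, total budget $\mathbf B\in\mathbb R_+^d$ and $\mathbf b=\mathbf B/T$, under the stationarity/independence and boundedness assumptions stated there. For any online policy $\pi$ satisfying the pathwise budget constraint $\sum_{t=1}^T\mathbf a_tx_t\le\mathbf B$ (componentwise, almost surely), the total reward $R_T^\pi=\sum_{t=1}^Tr_tx_t$ satisfies $$\mathbb E[R_T^\pi]\le T\cdot V^{\mathrm{mix}}(\mathbf b).$$
   Context: Problem. There are $T\in\mathbb N$ periods, $d$ resource types, a budget $\mathbf B\in\mathbb R_+^d$, and $K$ configurations $\Theta=\{1,\dots,K\}$; configuration $\theta$ has a distribution $\mathcal D_\theta$ of reward–resource pairs $(r,\mathbf a)\in\mathbb R_+\times\mathbb R_+^d$. In each period $t=1,\dots,T$ an online policy (1) selects $\theta_t\in\Theta$ based on the past history (and possibly internal randomization), (2) observes $(r_t,\mathbf a_t)\sim\mathcal D_{\theta_t}$, (3) irrevocably chooses $x_t\in\{0,1\}$ based on the past history, $\theta_t$ and $(r_t,\mathbf a_t)$ (and possibly internal randomization). If $x_t=1$, reward $r_t$ is collected and resources $\mathbf a_t$ are consumed. Assumptions. Stationarity and independence: if $\theta$ is selected in period $t$, then $(r_t,\mathbf a_t)$ is drawn from $\mathcal D_\theta$ independently (of the past and of the policy's randomization), and $\mathcal D_\theta$ does not depend on $t$. Boundedness: there are $R_{\max},A_{\max}>0$ such that for all $\theta$, $0\le r\le R_{\max}$ and $\|\mathbf a\|_\infty\le A_{\max}$ a.s. under $\mathcal D_\theta$.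 Mixed fluid value. With $\mathbb E_\theta$ the expectation under $\mathcal D_\theta$ and $\Delta_K$ the probability simplex in $\mathbb R^K$, $$V^{\mathrm{mix}}(\mathbf b):=\max_{\mathbf w\in\Delta_K}\ \max_{\{x_\theta\}}\Big\{\sum_{\theta}w_\theta\,\mathbb E_\theta[r\,x_\theta(r,\mathbf a)]\ :\ \sum_\theta w_\theta\,\mathbb E_\theta[\mathbf a\,x_\theta(r,\mathbf a)]\le\mathbf b\Big\},$$ the inner maximum being over families of measurable acceptance rules $x_\theta:\mathbb R_+\times\mathbb R_+^d\to[0,1]$, $\theta\in\Theta$. *)

(* Defs.v *)
From HB Require Import structures.
From mathcomp Require Import all_boot all_order all_algebra.
From mathcomp Require Import all_classical all_reals all_analysis.
Set Implicit Arguments.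
Unset Strict Implicit.
Unset Printing Implicit Defensive.
Import Order.TTheory GRing.Theory Num.Theory.
Import numFieldNormedType.Exports.
Local Open Scope classical_set_scope.
Local Open Scope ring_scope.

(* A reward-resource pair (r, a); tuples carry the product sigma-algebra, which
   is the Borel one on R^d. *)
Notation outcome R d := (R * d.-tuple R)%type.

(* What one period adds to the history: (theta_s, (r_s, a_s), x_s). The
   configuration is recorded by its number, nat being discretely measurable. *)
Notation step R d := (nat * outcome R d * bool)%type.

Definition orthant (R : realType) (d : nat) : set (outcome R d) :=
  [set z | 0 <= z.1 /\ forall j : 'I_d, 0 <= tnth z.2 j].

(* The distributions are measures on the whole of R x R^d. *)
Definition supported_on_orthant (R : realType) (d K : nat)
    (D : 'I_K -> probability (outcome R d) R) :=
  forall k : 'I_K, {ae D k, forall z, orthant z}.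

Definition bounded_by (R : realType) (d K : nat)
    (D : 'I_K -> probability (outcome R d) R) (Rmax Amax : R) :=
  forall k : 'I_K,
    {ae D k, forall z, 0 <= z.1 <= Rmax /\ forall j : 'I_d, `|tnth z.2 j| <= Amax}.

(* S is the space of the internal randomization: a seed in S is drawn once and
   is available at every decision, so it may encode fresh coins for each period.
   Periods are numbered from 0, and a history of length t lists its steps with
   the most recent one first. *)
Record policy (R : realType) (d K : nat) (dS : measure_display)
    (S : measurableType dS) := Policy {
  select : forall t : nat, S * t.-tuple (step R d) -> 'I_K;
  accept : forall t : nat, 'I_K -> S * t.-tuple (step R d) * outcome R d -> bool;
  measurable_select : forall (t : nat) (k : 'I_K),
    measurable [set h | select (t := t) h = k];
  measurable_accept : forall (t : nat) (k : 'I_K),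
    measurable_fun setT (accept (t := t) k) }.

(* The run of a policy on a seed U and a sequence Z of observed pairs. *)
Fixpoint history (R : realType) (d K : nat) (dS : measure_display)
    (S : measurableType dS) (Omega : Type) (pi : policy R d K S)
    (U : Omega -> S) (Z : nat -> Omega -> outcome R d) (t : nat) (om : Omega) :
    t.-tuple (step R d) :=
  match t with
  | 0 => [tuple]
  | s.+1 =>
    let h := (U om, history pi U Z s om) in
    let k := select pi h in
    [tuple of (val k, Z s om, accept pi k (h, Z s om)) :: h.2]
  end.

Definition information (R : realType) (d K : nat) (dS : measure_display)
    (S : measurableType dS) (Omega : Type) (pi : policy R d K S)
    (U : Omega -> S) (Z : nat -> Omega -> outcome R d) (t : nat) (om : Omega) :
    S * t.-tuple (step R d) :=
  (U om, history pi U Z t om).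

Definition config (R : realType) (d K : nat) (dS : measure_display)
    (S : measurableType dS) (Omega : Type) (pi : policy R d K S)
    (U : Omega -> S) (Z : nat -> Omega -> outcome R d) (t : nat) (om : Omega) :
    'I_K :=
  select pi (information pi U Z t om).

Definition decision (R : realType) (d K : nat) (dS : measure_display)
    (S : measurableType dS) (Omega : Type) (pi : policy R d K S)
    (U : Omega -> S) (Z : nat -> Omega -> outcome R d) (t : nat) (om : Omega) :
    bool :=
  accept pi (config pi U Z t om) (information pi U Z t om, Z t om).

(* On the event that k is selected in period t, the pair of period t has law D k
   independently of the past and of the randomization (future coins included);
   D does not depend on t. *)
Definition stationary_independent (R : realType) (d K : nat)
    (dS : measure_display) (S : measurableType dS)
    (dO : measure_display) (Omega : measurableType dO)
    (P : probability Omega R) (D : 'I_K -> probability (outcome R d) R)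
    (pi : policy R d K S) (U : Omega -> S) (Z : nat -> Omega -> outcome R d)
    (T : nat) :=
  forall (t : nat) (k : 'I_K) (A : set (S * t.-tuple (step R d)))
         (C : set (outcome R d)),
    (t < T)%N -> measurable A -> measurable C ->
    (P (information pi U Z t @^-1` A `&`
        [set om | config pi U Z t om = k] `&` Z t @^-1` C) =
     P (information pi U Z t @^-1` A `&`
        [set om | config pi U Z t om = k]) * D k C)%E.

Definition total_reward (R : realType) (d K : nat) (dS : measure_display)
    (S : measurableType dS) (Omega : Type) (pi : policy R d K S)
    (U : Omega -> S) (Z : nat -> Omega -> outcome R d) (T : nat) (om : Omega) : R :=
  \sum_(t < T) (Z t om).1 * (decision pi U Z t om)%:R.

Definition total_consumption (R : realType) (d K : nat) (dS : measure_display)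
    (S : measurableType dS) (Omega : Type) (pi : policy R d K S)
    (U : Omega -> S) (Z : nat -> Omega -> outcome R d) (T : nat) (j : 'I_d)
    (om : Omega) : R :=
  \sum_(t < T) tnth (Z t om).2 j * (decision pi U Z t om)%:R.

Definition simplex (R : realType) (K : nat) : set ('I_K -> R) :=
  [set w | (forall k, 0 <= w k) /\ \sum_(k < K) w k = 1].

(* Rules are defined on all of R x R^d; a rule on the orthant extends by 0, and
   its values off the orthant are irrelevant for laws supported there. *)
Definition acceptance_rule (R : realType) (d : nat) : set (outcome R d -> R) :=
  [set x : outcome R d -> R | measurable_fun setT x /\ forall z, 0 <= x z <= 1].

Definition fluid_reward (R : realType) (d K : nat)
    (D : 'I_K -> probability (outcome R d) R)
    (w : 'I_K -> R) (x : 'I_K -> outcome R d -> R) : \bar R :=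
  (\sum_(k < K) (w k)%:E * 'E_(D k)[fun z => (z.1 * x k z)%R])%E.

Definition fluid_consumption (R : realType) (d K : nat)
    (D : 'I_K -> probability (outcome R d) R)
    (w : 'I_K -> R) (x : 'I_K -> outcome R d -> R) (j : 'I_d) : \bar R :=
  (\sum_(k < K) (w k)%:E * 'E_(D k)[fun z => (tnth z.2 j * x k z)%R])%E.

(* The maximum is expressed as the supremum of the attainable values, taken in
   the extended reals, where it always exists. *)
Definition Vmix (R : realType) (d K : nat)
    (D : 'I_K -> probability (outcome R d) R) (b : d.-tuple R) : \bar R :=
  ereal_sup [set v | exists (w : 'I_K -> R) (x : 'I_K -> outcome R d -> R),
    [/\ simplex w, (forall k, acceptance_rule (x k)),
        (forall j : 'I_d, (fluid_consumption D w x j <= (tnth b j)%:E)%E) &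
        v = fluid_reward D w x]].

(* Main.v *)
Require Import Defs.
From HB Require Import structures.
From mathcomp Require Import all_boot all_order all_algebra.
From mathcomp Require Import all_classical all_reals all_analysis.
From mathcomp Require Import measurable_realfun.
Import Order.TTheory GRing.Theory Num.Theory.
Import numFieldNormedType.Exports.
Local Open Scope classical_set_scope.
Local Open Scope ring_scope.

(* Occupation measures. Let w_k be the expected fraction of periods in which
   configuration k is selected, and let x_k(z) be the probability that the pair z
   would be accepted, averaged over the periods and the histories at which k is
   selected. Given that k is selected, the pair of a period is independent of the
   history, so Tonelli's theorem identifies sum_k w_k E_k[g x_k] with 1/T times
   the expected total of g over the accepted pairs, for every g that is almost
   surely nonnegative. With g = a_j, the pathwise budget makes (w, x) feasible;
   with g = r, the fluid value of (w, x) is E[R_T] / T. *)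

(** * Restriction of a measure to an event, and Tonelli's theorem there *)

Lemma ge0_integral_mrestr {d} {T : measurableType d} {R : realType}
    (mu : {measure set T -> \bar R}) (E : set T) (mE : measurable E)
    (f : T -> \bar R) :
  measurable_fun [set: T] f -> (forall x, 0 <= f x)%E ->
  (\int[mrestr mu mE]_x f x = \int[mu]_(x in E) f x)%E.
Proof.
move=> mf f0; rewrite [LHS](@ge0_negligible_integral _ _ _ _ _ (~` E))//.
- rewrite setDE setCK setTI; apply: eq_measure_integral => A _ AE.
  by rewrite /= /mrestr setIidl.
- exact: measurableC.
- by rewrite /= /mrestr setICl.
Qed.

Section tonelli_on_event.
Context {d dX dY : measure_display} {T : measurableType d}
  {X : measurableType dX} {Y : measurableType dY} {R : realType}.
Variables (mu : {finite_measure set T -> \bar R}) (nu : probability Y R).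
Variables (E : set T) (f : T -> X) (g : T -> Y).
Hypotheses (mE : measurable E) (mf : measurable_fun [set: T] f)
  (mg : measurable_fun [set: T] g).
Hypothesis indep : forall A C, measurable A -> measurable C ->
  (mu (f @^-1` A `&` E `&` g @^-1` C) = mu (f @^-1` A `&` E) * nu C)%E.

(** The law of [f] on [E] is left unnormalised: nothing is divided by [mu E], and a null event is no
    special case. *)
Let law (A : set X) := mu (f @^-1` A `&` E).

Let mpre A : measurable A -> measurable (f @^-1` A).
Proof. by move=> mA; rewrite -[X in measurable X]setTI; exact: mf. Qed.

Let law_pushforward : law = pushforward (mrestr mu mE) f.
Proof. by []. Qed.

Let law0 : law set0 = 0%E.
Proof. by rewrite /law preimage_set0 set0I measure0. Qed.

Let law_ge0 A : (0 <= law A)%E.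
Proof. exact: measure_ge0. Qed.

Let law_sigma_additive : semi_sigma_additive law.
Proof.
rewrite law_pushforward; apply: measure_semi_sigma_additive; exact: mf.
Qed.

HB.instance Definition _ := isMeasure.Build _ _ _ law
  law0 law_ge0 law_sigma_additive.

Let law_fin : fin_num_fun law.
Proof.
move=> A mA; apply: fin_num_measure.
by apply: measurableI => //; exact: mpre.
Qed.

HB.instance Definition _ := Measure_isFinite.Build _ _ _ law law_fin.

Let mfg : measurable_fun [set: T] (fun t => (f t, g t)).
Proof. exact: measurable_fun_pair. Qed.

Variable h : X * Y -> \bar R.
Hypotheses (mh : measurable_fun [set: X * Y] h) (h0 : forall z, (0 <= h z)%E).

Let integral_law y :
  (\int[law]_x h (x, y) = \int[mu]_(t in E) h (f t, y))%E.
Proof.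
have my : measurable_fun [set: X] (fun x => h (x, y)).
  by apply: measurableT_comp => //; exact: pair2_measurable.
transitivity (\int[pushforward (mrestr mu mE) f]_x h (x, y))%E => //.
rewrite (ge0_integral_pushforward mf)// preimage_setT ge0_integral_mrestr//.
  exact: measurableT_comp my mf.
by move=> t; exact: h0.
Qed.

(** By [indep], the joint law of [(f, g)] on [E] agrees with the product of [law] and [nu] on
    rectangles, hence everywhere by uniqueness of the product measure; Tonelli then gives the
    iterated integral. *)
Lemma tonelli_on_event :
  (\int[mu]_(t in E) h (f t, g t) =
   \int[nu]_y \int[mu]_(t in E) h (f t, y))%E.
Proof.
under [RHS]eq_integral do rewrite -integral_law.
rewrite -[RHS](@fubini_tonelli2 _ _ _ _ _ law nu h mh h0).
rewrite -(ge0_integral_mrestr mu E mE (fun t => h (f t, g t))); last 2 first.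
- exact: measurableT_comp mh mfg.
- by move=> t; exact: h0.
transitivity (\int[pushforward (mrestr mu mE) (fun t => (f t, g t))]_z h z)%E.
  by rewrite (ge0_integral_pushforward mfg)// preimage_setT.
apply: eq_measure_integral => A mA _; apply/esym.
apply: product_measure_unique => // A1 A2 mA1 mA2.
rewrite -indep//= /pushforward /mrestr; congr (mu _).
by apply/seteqP; split => t /= [] [].
Qed.

(** This provides the measurability of [mean_acceptance], and so of the averaged acceptance rule. *)
Lemma measurable_integral_on_event :
  measurable_fun [set: Y] (fun y => (\int[mu]_(t in E) h (f t, y))%E).
Proof.
rewrite (_ : (fun y => _) = fubini_G law h); last first.
  by apply/funext => y; rewrite /fubini_G integral_law.
exact: measurable_fun_fubini_tonelli_G.
Qed.
End tonelli_on_event.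

Lemma measurable_natb (R : realType) :
  measurable_fun [set: bool] (fun b : bool => b%:R : R).
Proof. by []. Qed.

(** * Measurability of the run of a policy *)

Section policy_run.
Context {R : realType} {d K : nat} {dS dO : measure_display}
  {S : measurableType dS} {Omega : measurableType dO}.
Variables (pi : policy R d K S) (U : Omega -> S)
  (Z : nat -> Omega -> outcome R d) (T : nat).
Hypotheses (mU : measurable_fun [set: Omega] U)
  (mZ : forall t, (t < T)%N -> measurable_fun [set: Omega] (Z t)).

Lemma measurable_config_event t k :
  measurable_fun [set: Omega] (information pi U Z t) ->
  measurable [set om | config pi U Z t om = k].
Proof.
move=> mI; rewrite -[X in measurable X]setTI.
apply: (mI _ [set h | select pi (t := t) h = k]) => //.
exact: measurable_select.
Qed.

Lemma measurable_config_val t :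
  measurable_fun [set: Omega] (information pi U Z t) ->
  measurable_fun [set: Omega] (fun om => val (config pi U Z t om)).
Proof.
move=> mI _ B _; rewrite setTI.
rewrite (_ : _ @^-1` B = \bigcup_(k in [set k : 'I_K | B (val k)])
    [set om | config pi U Z t om = k]); last first.
  apply/seteqP; split => [om Bom|om [k Bk /= ->//]].
  by exists (config pi U Z t om).
apply: fin_bigcup_measurable => [|k _]; first exact: finite_finset.
exact: measurable_config_event.
Qed.

(** [accept] is measurable for each fixed configuration, so the acceptance event is cut into
    finitely many pieces along the selected configuration. *)
Lemma measurable_decision t :
  measurable_fun [set: Omega] (information pi U Z t) ->
  measurable_fun [set: Omega] (Z t) ->
  measurable_fun [set: Omega] (decision pi U Z t).
Proof.
move=> mI mZt; apply: (measurable_fun_bool true); rewrite setTI.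
rewrite (_ : _ @^-1` _ = \bigcup_(k in [set: 'I_K])
    ([set om | config pi U Z t om = k] `&`
     (fun om => accept pi k (information pi U Z t om, Z t om)) @^-1` [set true]));
    last first.
  apply/seteqP; split => [om dom|om [k _ [/= ck]]]; last by rewrite /decision ck.
  by exists (config pi U Z t om).
apply: fin_bigcup_measurable => [|k _]; first exact: finite_finset.
apply: measurableI; first exact: measurable_config_event.
rewrite -[X in measurable X]setTI.
by apply: (measurableT_comp (measurable_accept pi k)
  (measurable_fun_pair mI mZt)).
Qed.

Lemma measurable_information t : (t <= T)%N ->
  measurable_fun [set: Omega] (information pi U Z t).
Proof.
elim: t => [_|t IH tT].
  apply/measurable_fun_pairP; split => //.
  exact: measurable_cst.
have {}IH := IH (ltnW tT).
apply/measurable_fun_pairP; split => //=.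
apply: measurable_cons; last exact: measurableT_comp measurable_snd IH.
apply: measurable_fun_pair; last exact: (measurable_decision t IH (mZ t tT)).
apply: measurable_fun_pair; last exact: mZ.
exact: (measurable_config_val t IH).
Qed.

(** * Almost sure properties of observed pairs, and the partition by configuration *)

Variables (P : probability Omega R) (D : 'I_K -> probability (outcome R d) R).
Hypothesis sampling : stationary_independent P D pi U Z T.

(** Sampling with [A] the whole space shows that, while [k] is selected, [Z t] falls in a [D k]-null
    set with probability zero; there are finitely many [k]. *)
Lemma ae_observed t (Q : outcome R d -> Prop) : (t < T)%N ->
  (forall k, {ae D k, forall z, Q z}) -> {ae P, forall om, Q (Z t om)}.
Proof.
move=> tT aeQ.
have mI := measurable_information _ (ltnW tT).
have : {ae P, forall om, forall k, config pi U Z t om = k -> Q (Z t om)}.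
  apply: filter_forall => k; have [N [mN N0 QN]] := aeQ k.
  exists ([set om | config pi U Z t om = k] `&` Z t @^-1` N); split.
  - apply: measurableI; first exact: measurable_config_event.
    by rewrite -[X in measurable X]setTI; exact: mZ.
  - have := sampling _ k setT _ tT measurableT mN.
    by rewrite preimage_setT setTI N0 mule0.
  - move=> om /= /not_implyP[? nQ]; split => //; exact: QN.
by apply: filterS => om; exact.
Qed.

Let event t k := [set om | config pi U Z t om = k].

Lemma integral_config_partition t (F : Omega -> \bar R) : (t < T)%N ->
  measurable_fun [set: Omega] F -> (forall om, 0 <= F om)%E ->
  (\sum_(k < K) \int[P]_(om in event t k) F om = \int[P]_om F om)%E.
Proof.
move=> tT mF F0.
have mI := measurable_information _ (ltnW tT).
have UE : \big[setU/set0]_(k < K) event t k = setT.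
  rewrite -bigcup_seq; apply/seteqP; split => // om _.
  by exists (config pi U Z t om) => //=; rewrite mem_index_enum.
rewrite -ge0_integral_bigsetU ?UE//.
- by move=> k; exact: measurable_config_event.
- exact: index_enum_uniq.
- by move=> k l _ _ [om [/= ck cl]]; rewrite -ck -cl.
Qed.

(** * Acceptance probabilities of a fixed pair *)

Definition mean_acceptance t k (z : outcome R d) : \bar R :=
  (\int[P]_(om in event t k)
    ((accept pi k (information pi U Z t om, z))%:R)%:E)%E.

Lemma mean_acceptance_ge0 t k z : (0 <= mean_acceptance t k z)%E.
Proof. by apply: integral_ge0 => om _; rewrite lee_fin. Qed.

Let macc t k : measurable_fun [set: (S * t.-tuple (step R d)) * outcome R d]
    (fun h => ((accept pi k h)%:R : R)%:E).
Proof.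
apply/measurable_EFinP.
apply: (measurableT_comp (measurable_natb R)); exact: measurable_accept.
Qed.

(** The integral runs over the selection event without conditioning on it, hence this bound instead
    of [1]; it is what makes [average_rule] at most [1]. *)
Lemma mean_acceptance_le t k z : (t < T)%N ->
  (mean_acceptance t k z <= P (event t k))%E.
Proof.
move=> tT; have mI := measurable_information _ (ltnW tT).
have mE : measurable (event t k) by exact: measurable_config_event.
rewrite -[leRHS]mul1e -integral_cst//.
apply: ge0_le_integral => //.
- apply: measurable_funTS.
  apply: (measurableT_comp (macc t k)); exact: measurable_fun_pair.
- by move=> om _; rewrite lee_fin; case: (accept _ _ _); rewrite ?ler01.
Qed.

Lemma mean_acceptance_fin t k z : (t < T)%N ->
  mean_acceptance t k z \is a fin_num.
Proof.
move=> tT; rewrite ge0_fin_numE ?mean_acceptance_ge0//.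
apply: (le_lt_trans (mean_acceptance_le _ _ _ tT)).
by rewrite (le_lt_trans (probability_le1 _ _)) ?ltry//;
  apply: measurable_config_event; exact: measurable_information (ltnW tT).
Qed.

Lemma measurable_mean_acceptance t k : (t < T)%N ->
  measurable_fun [set: outcome R d] (mean_acceptance t k).
Proof.
move=> tT; have mI := measurable_information _ (ltnW tT).
apply: (measurable_integral_on_event P (event t k) (information pi U Z t) _ mI
  _ (macc t k)).
- exact: measurable_config_event.
- by move=> h; rewrite lee_fin.
Qed.

(** Tonelli on the selection event: the left side freezes the pair and averages over histories, the
    right side evaluates at the observed pair. *)
Lemma integral_mean_acceptance t k (g : outcome R d -> R) : (t < T)%N ->
  measurable_fun [set: outcome R d] g -> (forall z, 0 <= g z) ->
  (\int[D k]_z ((g z)%:E * mean_acceptance t k z) =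
   \int[P]_(om in event t k) (g (Z t om) * (decision pi U Z t om)%:R)%:E)%E.
Proof.
move=> tT mg g0; have mI := measurable_information _ (ltnW tT).
have mE : measurable (event t k) by exact: measurable_config_event.
pose h (y : (S * t.-tuple (step R d)) * outcome R d) :=
  (g y.2 * (accept pi k y)%:R)%:E.
have mh : measurable_fun setT h.
  apply/measurable_EFinP; apply: measurable_funM.
    exact: measurableT_comp mg measurable_snd.
  apply: (measurableT_comp (measurable_natb R)); exact: measurable_accept.
transitivity (\int[P]_(om in event t k) h (information pi U Z t om, Z t om))%E.
  rewrite (tonelli_on_event P (D k) (event t k) _ _ mE mI (mZ t tT) _ h mh)//.
  - apply: eq_integral => z _.
    rewrite -ge0_integralZl_EFin//.
    apply: measurable_funTS.
    by apply: (measurableT_comp (macc t k)); apply: measurable_fun_pair.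
  - by move=> A C mA mC; exact: sampling.
  - by move=> y; rewrite lee_fin mulr_ge0.
(* On this event the configuration is [k], so [decision] unfolds to [accept pi k]. *)
by apply: eq_integral => om; rewrite inE /event /h /decision /= => ->.
Qed.

(** * The averaged fluid solution *)

Definition selection_mass k : R := \sum_(t < T) fine (P (event t k)).

Definition selection_frequency k : R := selection_mass k / T%:R.

(** A ratio of sums: each period weighs by its probability of selecting [k], and the denominator
    cancels against [selection_frequency]. *)
Definition average_rule k (z : outcome R d) : R :=
  (\sum_(t < T) fine (mean_acceptance t k z)) / selection_mass k.

Let event_fin t k : (t < T)%N -> P (event t k) \is a fin_num.
Proof.
move=> tT; apply: fin_num_measure.
exact: (measurable_config_event t k (measurable_information t (ltnW tT))).
Qed.

Lemma selection_mass_ge0 k : 0 <= selection_mass k.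
Proof. by apply: sumr_ge0 => t _; rewrite fine_ge0. Qed.

Let numerator_ge0 k z : 0 <= \sum_(t < T) fine (mean_acceptance t k z).
Proof. by apply: sumr_ge0 => t _; rewrite fine_ge0// mean_acceptance_ge0. Qed.

Let numerator_le k z :
  \sum_(t < T) fine (mean_acceptance t k z) <= selection_mass k.
Proof.
apply: ler_sum => t _; apply: fine_le; first exact: mean_acceptance_fin.
  exact: event_fin.
exact: mean_acceptance_le.
Qed.

Lemma average_rule_acceptance k : acceptance_rule (average_rule k).
Proof.
split.
  apply: measurable_funM => //; apply: measurable_sum => t.
  apply: measurableT_comp => //; exact: measurable_mean_acceptance.
move=> z; rewrite /average_rule divr_ge0 ?selection_mass_ge0//=.
(* At zero mass the quotient is [0] by the convention on inverses, still a value in the unit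
   interval. *)
have [m0|m0] := eqVneq (selection_mass k) 0; first by rewrite m0 invr0 mulr0.
by rewrite ler_pdivrMr ?mul1r// lt0r m0 selection_mass_ge0.
Qed.

(* When [k] is never selected, [average_rule k] is [0] by [x / 0 = 0], and both
   sides vanish. *)
Lemma selection_frequencyM k z :
  selection_frequency k * average_rule k z =
  T%:R^-1 * \sum_(t < T) fine (mean_acceptance t k z).
Proof.
rewrite /selection_frequency /average_rule.
have [m0|m0] := eqVneq (selection_mass k) 0; last first.
  by rewrite mulrC mulrA divfK// mulrC.
have := numerator_le k z; rewrite m0 => n0.
rewrite !mul0r; apply/esym/eqP; rewrite mulf_eq0 orbC eq_le n0.
by rewrite numerator_ge0.
Qed.

Hypothesis T_gt0 : (0 < T)%N.

(** Exactly one configuration is selected per period, so each of the [T] periods contributes mass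
    [1]. *)
Lemma selection_frequency_simplex : simplex selection_frequency.
Proof.
split=> [k|]; first by rewrite divr_ge0 ?selection_mass_ge0.
rewrite -mulr_suml exchange_big /= (eq_bigr (fun=> 1)) => [|t _].
  by rewrite big_const_ord iter_addr_0 divff// pnatr_eq0 -lt0n.
apply: EFin_inj; rewrite -sumEFin -(@probability_setT _ _ _ P).
rewrite -[RHS]mul1e -integral_cst// -(integral_config_partition t)//.
apply: eq_bigr => k _; rewrite fineK ?event_fin// integral_cst ?mul1e//.
exact: (measurable_config_event t k (measurable_information t (ltnW (ltn_ord t)))).
Qed.

(* [g] is only almost surely nonnegative; the absolute value on the right makes
   Tonelli applicable without any integrability. *)
Lemma fluid_value (g : outcome R d -> R) :
  measurable_fun [set: outcome R d] g ->
  (forall k, {ae D k, forall z, 0 <= g z}) ->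
  (\sum_(k < K) (selection_frequency k)%:E *
     'E_(D k)[fun z => (g z * average_rule k z)%R] =
   (T%:R^-1)%:E * \sum_(t < T)
     \int[P]_om (`|g (Z t om)| * (decision pi U Z t om)%:R)%:E)%E.
Proof.
move=> mg aeg.
have mng : measurable_fun [set: outcome R d] (fun z => `|g z|).
  exact: measurableT_comp.
have mrule k : measurable_fun [set: outcome R d] (average_rule k).
  by have [] := average_rule_acceptance k.
have rule0 k z : 0 <= average_rule k z.
  by have [_ /(_ z)/andP[]] := average_rule_acceptance k.
have per_k k : ((selection_frequency k)%:E *
     'E_(D k)[fun z => (g z * average_rule k z)%R] =
   (T%:R^-1)%:E * \sum_(t < T) \int[P]_(om in event t k)
     (`|g (Z t om)| * (decision pi U Z t om)%:R)%:E)%E.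
  rewrite unlock (ae_eq_integral (fun z => (`|g z| * average_rule k z)%:E))//.
  (* The weight moves inside the integral, where [selection_frequencyM] replaces its product with
     the rule by a sum over periods; each period is then handled by [integral_mean_acceptance]. *)
  - rewrite -ge0_integralZl_EFin//.
    + rewrite (eq_integral (fun z => ((T%:R^-1)%:E * \sum_(t < T)
        (`|g z|%:E * mean_acceptance t k z))%E)); last first.
        move=> z _; rewrite -EFinM mulrCA selection_frequencyM mulrCA EFinM.
        congr (_ * _)%E; rewrite mulr_sumr -sumEFin; apply: eq_bigr => t _.
        by rewrite EFinM fineK// mean_acceptance_fin.
      rewrite ge0_integralZl_EFin//.
      * congr (_ * _)%E; rewrite ge0_integral_sum//.
        -- apply: eq_bigr => t _; exact: integral_mean_acceptance.
        -- move=> t; apply: emeasurable_funM; first exact/measurable_EFinP.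
           exact: measurable_mean_acceptance.
        -- by move=> t z _; rewrite mule_ge0 ?lee_fin ?mean_acceptance_ge0.
      * move=> z _; apply: sume_ge0 => t _.
        by rewrite mule_ge0 ?lee_fin ?mean_acceptance_ge0.
      * apply: emeasurable_sum => t.
        apply: emeasurable_funM; first exact/measurable_EFinP.
        exact: measurable_mean_acceptance.
    + by move=> z _; rewrite lee_fin mulr_ge0.
    + by apply/measurable_EFinP; exact: measurable_funM.
    + by case: selection_frequency_simplex.
  - by apply/measurable_EFinP; exact: measurable_funM.
  - by apply/measurable_EFinP; exact: measurable_funM.
  - by apply: filterS (aeg k) => z g0 _; rewrite ger0_norm.
rewrite (eq_bigr _ (fun k _ => per_k k)) -ge0_sume_distrr; last first.
  by move=> k _; apply: sume_ge0 => t _; apply: integral_ge0 => om _;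
    rewrite lee_fin mulr_ge0.
(* Within a period, the sum over [k] reassembles the integral over the whole space. *)
congr (_ * _)%E; rewrite exchange_big/=; apply: eq_bigr => t _.
have mI := measurable_information t (ltnW (ltn_ord t)).
rewrite integral_config_partition//.
  apply/measurable_EFinP; apply: measurable_funM.
    exact: measurableT_comp mng (mZ t (ltn_ord t)).
  apply: (measurableT_comp (measurable_natb R)).
  exact: (measurable_decision t mI (mZ t (ltn_ord t))).
Qed.

End policy_run.

(** * Feasibility of the averaged solution and comparison of rewards *)

Theorem theorem8 (R : realType) (T d K : nat) (B : d.-tuple R)
  (D : 'I_K -> probability (outcome R d) R) (Rmax Amax : R)
  (dS : measure_display) (S : measurableType dS) (pi : policy R d K S)
  (dO : measure_display) (Omega : measurableType dO) (P : probability Omega R)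
  (U : Omega -> S) (Z : nat -> Omega -> outcome R d)
  (T_gt0 : (0 < T)%N)
  (B_ge0 : forall j : 'I_d, 0 <= tnth B j)
  (D_orthant : supported_on_orthant D)
  (Rmax_gt0 : 0 < Rmax) (Amax_gt0 : 0 < Amax)
  (D_bounded : bounded_by D Rmax Amax)
  (U_measurable : measurable_fun setT U)
  (Z_measurable : forall t : nat, (t < T)%N -> measurable_fun setT (Z t))
  (Z_sampling : stationary_independent P D pi U Z T)
  (budget : {ae P, forall om, forall j : 'I_d,
     total_consumption pi U Z T j om <= tnth B j}) :
  ('E_P[total_reward pi U Z T] <=
     T%:R%:E * Vmix D [tuple (tnth B j / T%:R)%R | j < d])%E.
Proof.
have mT t : (t < T)%N -> forall g : outcome R d -> R, measurable_fun setT g ->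
    measurable_fun setT
      (fun om => `|g (Z t om)| * (decision pi U Z t om)%:R : R).
  move=> tT g mg.
  have mI := measurable_information pi U Z T U_measurable Z_measurable t (ltnW tT).
  have mdec := measurable_decision pi U Z t mI (Z_measurable t tT).
  apply: measurable_funM.
    apply: measurableT_comp => //; exact: measurableT_comp mg (Z_measurable t tT).
  exact: measurableT_comp (measurable_natb R) mdec.
have T0 : T%:R != 0 :> R by rewrite pnatr_eq0 -lt0n.
pose w := selection_frequency pi U Z T P.
pose x := average_rule pi U Z T P.
have value := fluid_value pi U Z T U_measurable Z_measurable P D Z_sampling T_gt0.
have feasible (j : 'I_d) : (fluid_consumption D w x j <=
    (tnth [tuple (tnth B i / T%:R)%R | i < d] j)%:E)%E.
  have mg : measurable_fun setT (fun z : outcome R d => tnth z.2 j).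
    exact: measurableT_comp (measurable_tnth j) measurable_snd.
  have aeg k : {ae D k, forall z, 0 <= tnth z.2 j}.
    by apply: filterS (D_orthant k) => z [].
  rewrite /fluid_consumption (value _ mg aeg) tnth_mktuple [(_ / _)%R]mulrC EFinM.
  apply: lee_wpmul2l; first by rewrite lee_fin invr_ge0.
  rewrite -ge0_integral_sum//; last first.
    by move=> t; apply/measurable_EFinP; exact: (mT t (ltn_ord t) _ mg).
  (* The budget becomes the integral of a constant, so that the pathwise constraint can be applied
     under the integral. *)
  rewrite -[leRHS]mule1 -(@probability_setT _ _ _ P) -integral_cst//.
  apply: ae_ge0_le_integral => //.
  - by move=> om _; apply: sume_ge0.
  - apply: emeasurable_sum => t; apply/measurable_EFinP.
    exact: (mT t (ltn_ord t) _ mg).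
  - by move=> om _; rewrite lee_fin.
  (* Almost sure nonnegativity of the observed resources removes the absolute values brought in by
     [fluid_value]. *)
  have aeZ : {ae P, forall om, forall t : 'I_T, 0 <= tnth (Z t om).2 j}.
    apply: filter_forall => t.
    exact: (ae_observed pi U Z T U_measurable Z_measurable P D Z_sampling t
      (fun z => 0 <= tnth z.2 j) (ltn_ord t) aeg).
  apply: filterS2 budget aeZ => om /(_ j) Bom Zom _.
  rewrite sumEFin lee_fin (le_trans _ Bom)// ler_sum// => t _.
  by rewrite ger0_norm.
have mr : measurable_fun setT (fun z : outcome R d => z.1) by exact: measurable_fst.
have aer k : {ae D k, forall z, 0 <= z.1}.
  by apply: filterS (D_orthant k) => z [].
(* The value of the feasible pair [(w, x)] lies below the supremum; it remains to bound the expected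
   reward by [T] times this value. *)
apply: (@le_trans _ _ (T%:R%:E * fluid_reward D w x)%E); last first.
  apply: lee_wpmul2l; first by rewrite lee_fin.
  apply: ereal_sup_ubound; exists w, x; split => //.
    exact: selection_frequency_simplex.
  exact: average_rule_acceptance.
rewrite /fluid_reward (value _ mr aer) muleA -EFinM divff// mul1e.
rewrite -ge0_integral_sum//; last first.
  by move=> t; apply/measurable_EFinP; exact: (mT t (ltn_ord t) _ mr).
(* Here the absolute values can stay: pointwise domination of the reward suffices for an upper
   bound. *)
have le_abs om : (`|(total_reward pi U Z T om)%:E| <=
    \sum_(t < T) (`|(Z t om).1| * (decision pi U Z t om)%:R)%:E)%E.
  rewrite sumEFin lee_fin (le_trans (ler_norm_sum _ _ _))// ler_sum// => t _.
  by rewrite normrM [`|_%:R|]ger0_norm.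
have mR : measurable_fun setT (fun om => (total_reward pi U Z T om)%:E).
  apply/measurable_EFinP; apply: measurable_sum => t; apply: measurable_funM.
    exact: measurableT_comp mr (Z_measurable t (ltn_ord t)).
  apply: (measurableT_comp (measurable_natb R)); apply: measurable_decision.
    exact: (measurable_information pi U Z T U_measurable Z_measurable t
      (ltnW (ltn_ord t))).
  exact: Z_measurable.
rewrite unlock (le_trans (lee_abs _))//.
rewrite (le_trans (le_abse_integral P measurableT mR))//.
apply: ge0_le_integral => //.
- exact: measurableT_comp.
- apply: emeasurable_sum => t; apply/measurable_EFinP.
  exact: (mT t (ltn_ord t) _ mr).
Qed.
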